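(* Let $K$ be a simplicial complex with $n$ vertices and let $H$ be a closed subgroup of the Lie group $G$. There is a (homotopy) fibration $$Z_K(EG,G/H)\longrightarrow Z_K(BG,BH)\longrightarrow (BG)^n .$$
   Context: A simplicial complex $K$ with $n$ vertices is a collection of subsets of $[n]=\{1,\dots,n\}$, closed under taking subsets, containing $\varnothing$ and every singleton $\{i\}$. For a pair $(X,A)$ the polyhedral product is $$Z_K(X,A)=\bigcup_{\sigma\in K}D(\sigma)\subseteq X^n,\qquad D(\sigma)=\prod_{i=1}^n Y_i,\quad Y_i=X \text{ if } i\in\sigma,\ Y_i=A\text{ if } i\notin\sigma.$$ $EG$ is a contractible space with free $G$-action and $BG=EG/G$. With $C(G/H)$ the cone on $G/H$, the inclusion $G/H\hookrightarrow C(G/H)$ gives a $G$-equivariant inclusion $EG\times G/H\hookrightarrow EG\times C(G/H)$ (diagonal $G$-actions), with $EG\times C(G/H)$ contractible and free; in this way $G/H$ is regarded as a $G$-equivariant subspace of $EG$. The pair $(EG,G/H)$ means $(EG\times C(G/H),\,EG\times G/H)$, and the pair $(BG,BH)$ means, up to homotopy equivalence of pairs, the quotient pair $(EG\times_G C(G/H),\,EG\times_G G/H)$, where $EG\times_G G/H\cong EG/H\simeq BH$. The map $Z_K(BG,BH)\to(BG)^n$ is the inclusion. Spaces are considered up to homotopy equivalence.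
   Formalization: EG is taken to be any contractible free G-space for which EG → EG/G is a numerable principal G-bundle (such as Milnor's); contractibility and freeness alone do not suffice, e.g. for Z² acting on the line by a dense group of translations, with H = 1 and K two points. *)

(* Defs.v *)
From HB Require Import structures.
From Stdlib Require Import Relations.
From mathcomp Require Import all_boot all_order all_algebra generic_quotient.
From mathcomp Require Import all_classical all_reals all_analysis.
Import Order.TTheory GRing.Theory Num.Theory numFieldNormedType.Exports.

Set Implicit Arguments.
Unset Strict Implicit.
Unset Printing Implicit Defensive.

Local Open Scope classical_set_scope.
Local Open Scope ring_scope.
Local Open Scope quotient_scope.

Definition I01 (R : realType) : topologicalType := set_type `[(0 : R), 1]%classic.
Arguments I01 : clear implicits.

Section Homotopy.
Variable R : realType.

Lemma I01_0_subproof : (0 : R) \in `[(0 : R), 1]%classic.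
Proof. by apply/mem_set; rewrite /= in_itv /= lexx ler01. Qed.

Lemma I01_1_subproof : (1 : R) \in `[(0 : R), 1]%classic.
Proof. by apply/mem_set; rewrite /= in_itv /= lexx ler01. Qed.

Definition I01_0 : I01 R := SigSub I01_0_subproof.
Definition I01_1 : I01 R := SigSub I01_1_subproof.

Definition homotopic (X Y : topologicalType) (f g : X -> Y) : Prop :=
  exists h : X * I01 R -> Y,
    [/\ continuous h, forall x, h (x, I01_0) = f x
      & forall x, h (x, I01_1) = g x].

Definition homotopy_equivalence (X Y : topologicalType) (f : X -> Y) : Prop :=
  continuous f /\
  exists g : Y -> X,
    [/\ continuous g, homotopic (g \o f) id & homotopic (f \o g) id].

Definition contractible (X : topologicalType) : Prop :=
  exists x0 : X, homotopic (@id X) (cst x0).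

Definition homotopy_fiber (X B : topologicalType) (p : X -> B) (b : B) :
    set (X * {compact-open, I01 R -> B}) :=
  [set w | [/\ continuous (w.2 : I01 R -> B), w.2 I01_0 = p w.1
             & w.2 I01_1 = b]].

(* A lift [h] of [j] to the homotopy fiber is the same thing as a null-homotopy
   of [p \o j]. *)
Definition homotopy_fibration (F X B : topologicalType)
    (j : F -> X) (p : X -> B) : Prop :=
  [/\ continuous j, continuous p &
    forall b : B, exists h : F -> set_type (homotopy_fiber p b),
      homotopy_equivalence h /\ forall x, (val (h x)).1 = j x].

End Homotopy.

Section Quotient.
Variables (T : topologicalType) (E : relation T).

Definition gen_eq (x y : T) : bool := `[< clos_refl_sym_trans T E x y >].

Lemma gen_eq_refl : reflexive gen_eq.
Proof. by move=> x; apply/asboolP; apply: rst_refl. Qed.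

Lemma gen_eq_sym : symmetric gen_eq.
Proof. by move=> x y; apply/asboolP/asboolP; apply: rst_sym. Qed.

Lemma gen_eq_trans : transitive gen_eq.
Proof.
by move=> y x z /asboolP xy /asboolP yz; apply/asboolP; apply: rst_trans yz.
Qed.

Definition gen_equiv : equiv_rel T :=
  EquivRel gen_eq gen_eq_refl gen_eq_sym gen_eq_trans.

(* The quotient of [T] by the equivalence relation generated by [E]. *)
Definition quotient_space : topologicalType :=
  quotient_topology {eq_quot gen_equiv}.

Definition quotient_proj (x : T) : quotient_space := \pi_{eq_quot gen_equiv} x.

Definition quotient_repr (y : quotient_space) : T :=
  repr (y : {eq_quot gen_equiv}).

Lemma quotient_reprK (y : quotient_space) : quotient_proj (quotient_repr y) = y.
Proof. exact: reprK. Qed.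

Lemma quotient_projP (x y : T) :
  quotient_proj x = quotient_proj y <-> clos_refl_sym_trans T E x y.
Proof.
split=> [/eqmodP/asboolP //|xy]; first exact/eqmodP/asboolP.
Qed.

Lemma quotient_proj_continuous : continuous quotient_proj.
Proof. exact: (@pi_continuous T {eq_quot gen_equiv}). Qed.

End Quotient.

(* The map induced on quotients by a map compatible with the relations;
   see [quotient_mapE]. *)
Definition quotient_map (T U : topologicalType) (E : relation T)
    (E' : relation U) (f : T -> U) (y : quotient_space E) : quotient_space E' :=
  quotient_proj E' (f (quotient_repr y)).

Lemma quotient_mapE (T U : topologicalType) (E : relation T) (E' : relation U)
    (f : T -> U) (x : T) :
  (forall a b, E a b -> clos_refl_sym_trans U E' (f a) (f b)) ->
  quotient_map E' f (quotient_proj E x) = quotient_proj E' (f x).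
Proof.
move=> fE; apply/quotient_projP.
have : clos_refl_sym_trans T E (quotient_repr (quotient_proj E x)) x.
  by apply/quotient_projP; rewrite quotient_reprK.
move: (quotient_repr _) => y; elim=> [a b /fE //|a|a b _|a b c _ ab _ bc].
- exact: rst_refl.
- exact: rst_sym.
- exact: rst_trans bc.
Qed.

HB.mixin Record isTopologicalGroup G & Group G & Topological G := {
  mulg_continuous : continuous (fun p : G * G => (p.1 * p.2)%g);
  invg_continuous : continuous (fun x : G => (x^-1)%g)
}.

#[short(type="topologicalGroupType")]
HB.structure Definition TopologicalGroup :=
  {G of Group G & Topological G & isTopologicalGroup G}.

(* Used for finite-dimensional [V] only: there [f] is [C^k] on the open set [U]
   iff all its iterated directional derivatives up to order [k] exist and are
   continuous on [U]. *)
Fixpoint differentiable_class (R : realType) (V W : normedModType R) (k : nat)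
    (U : set V) (f : V -> W) : Prop :=
  (forall x, U x -> {for x, continuous f}) /\
  match k with
  | 0%N => True
  | k'.+1 => forall v : V, (forall x, U x -> derivable f x v) /\
                           differentiable_class k' U ('D_v f)
  end.

Definition smooth_on (R : realType) (V W : normedModType R) (U : set V)
    (f : V -> W) : Prop :=
  forall k, differentiable_class k U f.

Record chart (R : realType) (M : topologicalType) (d : nat) := Chart {
  chart_dom : set M;
  chart_map : M -> 'rV[R]_d;
  chart_inv : 'rV[R]_d -> M;
  chart_dom_open : open chart_dom;
  chart_img_open : open (chart_map @` chart_dom);
  chart_mapK : forall x, chart_dom x -> chart_inv (chart_map x) = x;
  chart_map_continuous : {within chart_dom, continuous chart_map};
  chart_inv_continuous : {within chart_map @` chart_dom, continuous chart_inv}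
}.

Definition chart_img (R : realType) (M : topologicalType) (d : nat)
  (a : chart R M d) : set 'rV[R]_d := chart_map a @` chart_dom a.

Definition smooth_atlas (R : realType) (M : topologicalType) (d : nat)
    (A : set (chart R M d)) : Prop :=
  (forall x, exists2 a, A a & chart_dom a x) /\
  (forall a b, A a -> A b ->
     smooth_on [set u | chart_img a u /\ chart_dom b (chart_inv a u)]
               (chart_map b \o chart_inv a)).

Definition lie_group (R : realType) (G : topologicalGroupType) : Prop :=
  [/\ hausdorff_space G, @second_countable G &
    exists (d : nat) (A : set (chart R G d)),
    [/\ smooth_atlas A,
        forall a b c, A a -> A b -> A c ->
          smooth_on
            [set u : 'rV[R]_d * 'rV[R]_d |
              [/\ chart_img a u.1, chart_img b u.2 &
                  chart_dom c (chart_inv a u.1 * chart_inv b u.2)%g]]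
            (fun u => chart_map c (chart_inv a u.1 * chart_inv b u.2)%g)
      & forall a b, A a -> A b ->
          smooth_on
            [set u | chart_img a u /\ chart_dom b ((chart_inv a u)^-1)%g]
            (fun u => chart_map b ((chart_inv a u)^-1)%g)]].

Definition closed_subgroup (G : topologicalGroupType) (H : set G) : Prop :=
  [/\ closed H, H 1%g, forall x y, H x -> H y -> H (x * y)%g
    & forall x, H x -> H (x^-1)%g].

Section Actions.
Variable G : topologicalGroupType.

Section OrbitSpace.
Variables (E : topologicalType) (act : G -> E -> E).

Definition continuous_action : Prop :=
  [/\ forall x, act 1%g x = x,
      forall g h x, act (g * h)%g x = act g (act h x)
    & continuous (fun p : G * E => act p.1 p.2)].

Definition free_action : Prop := forall g x, act g x = x -> g = 1%g.

Definition orbit_rel : relation E := fun x y => exists g, y = act g x.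

Definition orbit_space : topologicalType := quotient_space orbit_rel.
Definition orbit_proj : E -> orbit_space := quotient_proj orbit_rel.

(* [(orbit_proj, tau)] is a [G]-homeomorphism from the preimage of [U] onto
   [U * G], with inverse [s]; [G] acts on itself by left translation. *)
Definition trivial_over (U : set orbit_space) : Prop :=
  exists (tau : E -> G) (s : orbit_space * G -> E),
    [/\ {within orbit_proj @^-1` U, continuous tau},
        {within U `*` setT, continuous s},
        forall g x, U (orbit_proj x) -> tau (act g x) = (g * tau x)%g,
        forall x, U (orbit_proj x) -> s (orbit_proj x, tau x) = x
      & forall b g, U b -> orbit_proj (s (b, g)) = b /\ tau (s (b, g)) = g].

End OrbitSpace.

Definition numerable_cover (R : realType) (B : topologicalType)
    (I : choiceType) (U : I -> set B) : Prop :=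
  exists u : I -> B -> R,
    [/\ forall i, continuous (u i),
        forall i b, 0 <= u i b,
        forall b : B, exists2 N : set B, nbhs b N
          & finite_set [set i | exists2 y, N y & u i y != 0],
        forall b, \sum_(i \in [set: I]) u i b = 1
      & forall i, closure [set b | u i b != 0] `<=` U i].

Definition numerable_principal (R : realType) (E : topologicalType)
    (act : G -> E -> E) : Prop :=
  exists (I : choiceType) (U : I -> set (orbit_space act)),
    [/\ forall i, open (U i), numerable_cover R U
      & forall i, trivial_over (U i)].

(* A contractible free [G]-space [E] such that [E -> E/G] is a numerable
   principal [G]-bundle, i.e. the total space of a universal [G]-bundle.
   Freeness and contractibility alone do not suffice: the translation action on
   the line of a dense finitely generated subgroup, taken with the discrete
   topology, is free, but the quotient is indiscrete. Numerability is what gives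
   the covering homotopy property with respect to all spaces. *)
Definition universal_space (R : realType) (E : topologicalType)
    (act : G -> E -> E) : Prop :=
  [/\ continuous_action act, free_action act, contractible R E
    & numerable_principal R act].

Definition diag_action (X Y : topologicalType) (aX : G -> X -> X)
    (aY : G -> Y -> Y) (g : G) (p : X * Y) : X * Y :=
  (aX g p.1, aY g p.2).

Definition coset_rel (H : set G) : relation G := fun x y => H (x^-1 * y)%g.

Definition coset_space (H : set G) : topologicalType :=
  quotient_space (coset_rel H).

Definition coset_action (H : set G) (g : G) : coset_space H -> coset_space H :=
  quotient_map (coset_rel H) (fun x => (g * x)%g).

Lemma coset_actionE (H : set G) (g x : G) :
  coset_action g (quotient_proj (coset_rel H) x) =
  quotient_proj (coset_rel H) (g * x)%g.
Proof.
apply: quotient_mapE => a b ab; apply: rst_step.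
by rewrite /coset_rel invgM -mulgA mulKg.
Qed.

End Actions.

Section Cone.
Variables (R : realType) (Y : topologicalType).

(* The end [Y * {0}] is collapsed; [Y] is included as the end [Y * {1}]. *)
Definition cone_rel : relation (Y * I01 R) :=
  fun p q => p.2 = I01_0 R /\ q.2 = I01_0 R.

Definition cone : topologicalType := quotient_space cone_rel.

Definition cone_base (y : Y) : cone := quotient_proj cone_rel (y, I01_1 R).

Definition cone_action (G : Type) (aY : G -> Y -> Y) (g : G) : cone -> cone :=
  quotient_map cone_rel (fun p => (aY g p.1, p.2)).

Lemma cone_actionE (G : Type) (aY : G -> Y -> Y) (g : G) (y : Y) (t : I01 R) :
  cone_action aY g (quotient_proj cone_rel (y, t)) =
  quotient_proj cone_rel (aY g y, t).
Proof. by apply: quotient_mapE => a b ab; apply: rst_step. Qed.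

End Cone.

Definition simplicial_complex (n : nat) (K : {set {set 'I_n}}) : Prop :=
  [/\ finset.set0 \in K,
      forall i : 'I_n, finset.set1 i \in K
    & forall s t : {set 'I_n}, s \in K -> t \subset s -> t \in K].

Definition power (n : nat) (X : topologicalType) : topologicalType :=
  prod_topology (fun _ : 'I_n => X).

Section PolyhedralProduct.
Variables (n : nat) (K : {set {set 'I_n}}).

Definition polyhedral_product (X : topologicalType) (A : set X) :
    set (power n X) :=
  \bigcup_(s in [set s : {set 'I_n} | s \in K])
    [set x | forall i, (if i \in s then setT else A) (x i)].

Lemma polyhedral_map_subproof (X Y : topologicalType) (A : set X) (f : X -> Y)
    (x : set_type (polyhedral_product A)) :
  ((fun i => f (val x i)) : power n Y) \in polyhedral_product (f @` A).
Proof.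
have [s Ks sx] := set_valP x; apply/mem_set; exists s => // i.
by have := sx i; case: ifP => // _ Axi; exists (val x i).
Qed.

Definition polyhedral_map (X Y : topologicalType) (A : set X) (f : X -> Y)
    (x : set_type (polyhedral_product A)) :
    set_type (polyhedral_product (f @` A)) :=
  SigSub (polyhedral_map_subproof f x).

Definition polyhedral_incl (X : topologicalType) (A : set X)
    (x : set_type (polyhedral_product A)) : power n X :=
  val x.

End PolyhedralProduct.

Arguments polyhedral_map {n} K {X Y} A f x.
Arguments polyhedral_incl {n} K {X} A x.

(* [EG] is the given universal [G]-space. The pairs written [(EG, G/H)] and
   [(BG, BH)] are [(EG * C(G/H), EG * G/H)] and its quotient by [G]. *)
Section Pairs.
Variables (R : realType) (G : topologicalGroupType) (H : set G).
Variables (EG : topologicalType) (act : G -> EG -> EG).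

Definition EG_cone : topologicalType := (EG * cone R (coset_space H))%type.

Definition EG_cone_action : G -> EG_cone -> EG_cone :=
  diag_action act (cone_action (R := R) (coset_action (H := H))).

Definition EG_cosets : set EG_cone :=
  [set p | exists y : coset_space H, p.2 = cone_base R y].

Definition BG_cone : topologicalType := orbit_space EG_cone_action.

Definition EG_to_BG : EG_cone -> BG_cone := orbit_proj EG_cone_action.

(* [EG *_G G/H], as the image of the [G]-invariant subspace [EG * G/H]. *)
Definition BH_sub : set BG_cone := EG_to_BG @` EG_cosets.

End Pairs.

Arguments EG_cosets R {G} H EG.
Arguments EG_to_BG R {G} H {EG} act.
Arguments BG_cone R {G} H {EG} act.
Arguments BH_sub R {G} H {EG} act.

(* Main.v *)
Require Import Defs.
From mathcomp Require Import all_boot all_order all_algebra.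
From mathcomp Require Import all_classical all_reals all_analysis.
From Stdlib Require Import Relations.
From mathcomp Require Import generic_quotient lra.
Import Order.TTheory GRing.Theory Num.Theory numFieldNormedType.Exports.

Set Implicit Arguments.
Unset Strict Implicit.
Unset Printing Implicit Defensive.

Local Open Scope classical_set_scope.
Local Open Scope ring_scope.
Local Open Scope quotient_scope.

(** Write [E] for the product of [EG] with the cone on [G/H], [A] for
    [EG * G/H] and [q] for the orbit map of [E]. The statement holds because
    [q], taken in each of the [n] coordinates, is a principal bundle with
    contractible total space whose restriction over the polyhedral product of
    the quotient pair is the polyhedral product of [(E, A)]: as [A] is a
    union of orbits, a point of [E ^ n] lies in the latter as soon as its image
    lies in the former ([polyhedral_productP]).

    A contraction of [E] joins each point of the polyhedral product to a point
    chosen over the base point [b], and the images of these paths give the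
    map [h] to the homotopy fiber. Conversely, a point of the homotopy
    fiber is a point with a path to [b]; lifting the reversed path from the
    chosen point, one coordinate at a time, ends in the polyhedral product.
    The two composites are homotopic to the identity for different reasons.
    Starting upstairs, one compares two paths with the same image and the same
    end point; they differ by a path in [G ^ n] that ends at the
    identity, and moving along it is the homotopy
    ([translation_continuous]). Starting in the homotopy fiber, one compares two
    paths in [E ^ n] with the same end points; they are homotopic because
    [E] is contractible, continuously in the path
    ([contractible_paths]).

    The main ingredient is the covering homotopy property with respect to all
    spaces, for a numerable principal bundle ([covering_homotopy]). A numerable
    cover is first made countable
    ([countable_trivialization_of_partition]). Then a homotopy is lifted by
    countably many steps, each performed for all parameters at once in
    one trivialisation; the length of a step is a continuous function of the
    parameter that vanishes where the trivialisation is not available.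

    That [G] is a Lie group enters through local compactness. The
    topology of a cone is that of a quotient by a map which is not open, and the
    action of [G] on it is jointly continuous because the product of a quotient
    map with a locally compact space is a quotient map
    ([quotient_prod_continuous], [continuous_action_quotient]). *)

(** * Continuity in products, infima and the unit interval *)

Lemma continuous_pair (X Y Z : topologicalType) (f : X -> Y) (g : X -> Z) :
  continuous f -> continuous g -> continuous (fun x => (f x, g x)).
Proof. by move=> cf cg x; apply: cvg_pair; [apply: cf|apply: cg]. Qed.

Lemma continuous_compose (X Y Z : topologicalType) (g : Y -> Z) (f : X -> Y) :
  continuous g -> continuous f -> continuous (fun x => g (f x)).
Proof. by move=> cg cf x; apply: (continuous_comp (cf x) (cg _)). Qed.

Lemma continuous_fst (X Y : topologicalType) :
  continuous (fst : X * Y -> X).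
Proof. by move=> x; apply: cvg_fst. Qed.

Lemma continuous_snd (X Y : topologicalType) :
  continuous (snd : X * Y -> Y).
Proof. by move=> x; apply: cvg_snd. Qed.

Lemma continuous_prod_topology (I : Type) (X : topologicalType)
    (T : I -> topologicalType) (f : X -> prod_topology T) :
  (forall i, continuous (fun x => f x i)) -> continuous f.
Proof.
move=> cf x; apply/cvg_sup => i.
exact: (@continuous_comp_initial _ _ _ (fun g : prod_topology T => g i) f (cf i)).
Qed.

Lemma continuous_eval_at (I : eqType) (T : I -> topologicalType) (i : I) :
  continuous (fun f : prod_topology T => f i).
Proof. exact: (@proj_continuous I T i). Qed.

Lemma continuous_val (X : topologicalType) (A : set X) :
  continuous (val : set_type A -> X).
Proof. exact: initial_continuous. Qed.

Lemma continuous_set_type (X Y : topologicalType) (A : set Y)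
    (f : X -> set_type A) :
  continuous (fun x => val (f x)) -> continuous f.
Proof. exact: continuous_comp_initial. Qed.

Lemma near_eq_continuous_at (X Y : topologicalType) (f g : X -> Y) (x : X) :
  (\forall y \near x, f y = g y) -> {for x, continuous g} ->
  {for x, continuous f}.
Proof.
move=> fg cg; rewrite /prop_for /continuous_at (nbhs_singleton fg).
apply: cvg_trans cg; apply: near_eq_cvg.
by apply: filterS fg => y ->.
Qed.

Section Infimum.
Variable R : realType.

(** Continuity that is uniform in the index passes to the infimum; both locally
    finite families and families indexed by a compact space are of this kind. *)
Lemma inf_range_continuous_at (J : Type) (j0 : J) (X : topologicalType)
    (g : X -> J -> R) (m : R) (x : X) :
  (forall y j, m <= g y j) ->
  (forall e, 0 < e -> \forall y \near x, forall j, `|g y j - g x j| <= e) ->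
  {for x, continuous (fun y => inf (range (g y)))}.
Proof.
move=> mg gx; apply/cvgrPdist_le => e e0.
have lb y : has_lbound (range (g y)) by exists m => _ [j _ <-].
have ne y : (range (g y)) !=set0 by exists (g y j0), j0.
apply: filterS (gx e e0) => y gy.
have l1 : inf (range (g x)) - e <= inf (range (g y)).
  apply: lb_le_inf => // _ [j _ <-].
  have := ge_inf (lb x) (imageT (g x) j); have := gy j; rewrite ler_norml; lra.
have l2 : inf (range (g y)) - e <= inf (range (g x)).
  apply: lb_le_inf => // _ [j _ <-].
  have := ge_inf (lb y) (imageT (g y) j); have := gy j; rewrite ler_norml; lra.
by rewrite ler_norml; lra.
Qed.

Lemma inf_range_compact_continuous (J : topologicalType) (j0 : J)
    (X : topologicalType) (g : X * J -> R) :
  compact [set: J] -> continuous g -> (forall p, 0 <= g p) ->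
  continuous (fun x => inf (range (fun j => g (x, j)))).
Proof.
move=> cJ cg g0 x; apply: (@inf_range_continuous_at J j0 X (fun x j => g (x, j)) 0).
  by move=> *.
move=> e e0.
move/compact_near_coveringP: cJ.
move=> /(_ _ (nbhs x) (fun y j => `|g (y, j) - g (x, j)| <= e)) H.
have {}H : \forall y \near x, [set: J] `<=` (fun j => `|g (y, j) - g (x, j)| <= e).
  apply: H => j _.
  have e2 : 0 < e / 2 by rewrite divr_gt0.
  have /cvgrPdist_le/(_ _ e2) [[A B] [/= Ax Bj] AB] := cg (x, j).
  exists (B, A) => // -[j' y] [/= Bj' Ay].
  have := AB (y, j') (conj Ay Bj'); have := AB (x, j') (conj (nbhs_singleton Ax) Bj').
  rewrite /= !ler_norml; lra.
by apply: filterS H => y H j; apply: H.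
Qed.

End Infimum.

Section RealFunctions.
Variables (R : realType) (X : topologicalType) (f g : X -> R).
Hypotheses (cf : continuous f) (cg : continuous g).

Lemma continuous_maxr : continuous (fun x => Num.max (f x) (g x)).
Proof. by move=> x; exact: (continuous_max (@cf x) (@cg x)). Qed.

Lemma continuous_minr : continuous (fun x => Num.min (f x) (g x)).
Proof. by move=> x; exact: (continuous_min (@cf x) (@cg x)). Qed.

Lemma continuous_addr : continuous (fun x => f x + g x).
Proof. by move=> x; apply: cvgD; [exact: cf|exact: cg]. Qed.

Lemma continuous_subr : continuous (fun x => f x - g x).
Proof. by move=> x; apply: cvgB; [exact: cf|exact: cg]. Qed.

Lemma continuous_mulr : continuous (fun x => f x * g x).
Proof. by move=> x; apply: cvgM; [exact: cf|exact: cg]. Qed.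

Lemma near_lt_continuous (x : X) (c : R) : f x < c -> \forall y \near x, f y < c.
Proof. by move=> fxc; exact: (@cf x _ (lt_nbhsl fxc)). Qed.

Lemma near_gt_continuous (x : X) (c : R) : c < f x -> \forall y \near x, c < f y.
Proof. by move=> fxc; exact: (@cf x _ (lt_nbhsr fxc)). Qed.

End RealFunctions.

Lemma continuous_const (X Y : topologicalType) (y : Y) :
  continuous (fun _ : X => y).
Proof. by move=> x; exact: cvg_cst. Qed.

Lemma continuous_id (X : topologicalType) : continuous (fun x : X => x).
Proof. by move=> x; exact: cvg_id. Qed.

Section UnitInterval.
Variable R : realType.

Lemma clamp_subproof (t : R) :
  (Num.max 0 (Num.min 1 t)) \in `[(0 : R), 1]%classic.
Proof. by apply/mem_set; rewrite /= in_itv /= le_max lexx ge_max ler01 ge_min lexx. Qed.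

Definition clamp (t : R) : I01 R := SigSub (clamp_subproof t).

Lemma I01P (t : I01 R) : 0 <= val t <= 1.
Proof. by have := set_valP t; rewrite /= in_itv. Qed.

Lemma clampK (t : I01 R) : clamp (val t) = t.
Proof.
apply: val_inj => /=; have /andP[t0 t1] := I01P t.
by rewrite min_r // max_r.
Qed.

Lemma clamp_le0 (t : R) : t <= 0 -> clamp t = I01_0 R.
Proof.
move=> t0; apply: val_inj => /=; rewrite min_r ?max_l //.
exact: le_trans t0 ler01.
Qed.

Lemma clamp_ge1 (t : R) : 1 <= t -> clamp t = I01_1 R.
Proof. by move=> t1; apply: val_inj => /=; rewrite min_l // max_r. Qed.

Lemma val_clamp (t : R) : 0 <= t -> t <= 1 -> val (clamp t) = t.
Proof. by move=> t0 t1 /=; rewrite min_r // max_r. Qed.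

Lemma clamp_continuous : continuous clamp.
Proof.
apply: continuous_set_type.
apply: continuous_maxr; first exact: continuous_const.
by apply: continuous_minr; [exact: continuous_const|exact: continuous_id].
Qed.

Lemma I01_compact : compact [set: I01 R].
Proof.
have -> : [set: I01 R] = clamp @` `[(0 : R), 1]%classic.
  by apply/seteqP; split=> // t _; exists (val t); [exact: set_valP|exact: clampK].
apply: continuous_compact; last exact: segment_compact.
exact/continuous_subspaceT/clamp_continuous.
Qed.

Lemma I01_locally_compact : locally_compact [set: I01 R].
Proof.
move=> x _; rewrite withinET; exists setT; first exact: filterT.
by split; [exact: I01_compact|exact: closedT].
Qed.

Lemma I01_regular : regular_space (I01 R).
Proof. exact: (@uniform_regular (set_type `[(0 : R), 1]%classic)). Qed.

End UnitInterval.

(** * Maps out of a quotient times a locally compact space *)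

Lemma quotient_space_continuous (T Z : topologicalType) (E : relation T)
    (f : quotient_space E -> Z) :
  continuous (fun x => f (quotient_proj E x)) -> continuous f.
Proof. by move=> cf; apply/(@quotient_continuous T {eq_quot (gen_equiv E)} Z f). Qed.

(** The product of a quotient map with a locally compact regular [L] is again
    a quotient map: by currying, maps out of it are maps from the quotient to
    the space of maps out of [L]. *)
Lemma quotient_prod_continuous (T L Z : topologicalType) (E : relation T)
    (f : quotient_space E * L -> Z) :
  locally_compact [set: L] -> regular_space L ->
  continuous (fun p : T * L => f (quotient_proj E p.1, p.2)) ->
  continuous f.
Proof.
move=> lcL rL cf.
have -> : f = uncurry (curry f) by apply/funext => -[].
have [c1 c2] := continuous_curry cf.
apply: continuous_uncurry_regular => //.
  exact: (@quotient_space_continuous T {compact-open, L -> Z} E (curry f)).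
by move=> u; have := c2 (quotient_repr u); rewrite /curry /= quotient_reprK.
Qed.

(** * The covering homotopy property *)

Section CoveringHomotopy.
Variables (R : realType) (E B : topologicalType) (q : E -> B).

(** A form of numerable local triviality that does not mention the fibre:
    [tr k (e, b)] transports [e] to the fibre over [b] within a trivialisation
    over the set where [v k] is positive. It is total so that the
    identity [tr k (e, q e) = e] holds even off that set. *)
Definition local_transport (v : nat -> B -> R) (tr : nat -> E * B -> E) : Prop :=
  [/\ forall k, continuous (v k),
      forall k b, 0 <= v k b,
      forall b, exists k, 0 < v k b
    & forall k,
      [/\ forall e b, 0 < v k (q e) -> 0 < v k b -> {for (e, b), continuous (tr k)},
          forall e b, q (tr k (e, b)) = b
        & forall e, tr k (e, q e) = e]].

Variables (v : nat -> B -> R) (tr : nat -> E * B -> E).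
Hypothesis vtr : local_transport v tr.

Variables (W : topologicalType) (gamma : W * I01 R -> B) (f : W -> E).
Hypothesis gammac : continuous gamma.
Hypothesis fc : continuous f.
Hypothesis qf : forall w, q (f w) = gamma (w, I01_0 R).

Let g (p : W * R) : B := gamma (p.1, clamp p.2).

Let g_continuous : continuous g.
Proof.
apply: continuous_compose gammac _; apply: continuous_pair.
  exact: continuous_fst.
by apply: continuous_compose; [exact: clamp_continuous|exact: continuous_snd].
Qed.

(* The lift can be advanced from time [t] by [step k d (w, t)] within the
   [k]-th trivialisation. Subtracting [d] makes the step vanish on a whole
   neighbourhood of the points where that trivialisation is not available; without
   this the extended lift could be discontinuous there. *)
Let step (k : nat) (d : R) (p : W * R) : R :=
  Num.min d (Num.max 0
    (inf (range (fun s : I01 R => v k (g (p.1, p.2 + d * val s)))) - d)).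

Let step_continuous (k : nat) (d : R) : continuous (step k d).
Proof.
case: vtr => vc v0 _ _; apply: continuous_minr; first exact: continuous_const.
apply: continuous_maxr; first exact: continuous_const.
apply: continuous_subr; last exact: continuous_const.
apply: (@inf_range_compact_continuous R (I01 R) (I01_0 R) _
  (fun x => v k (g (x.1.1, x.1.2 + d * val x.2)))).
- exact: I01_compact.
- apply: continuous_compose (vc k) _; apply: continuous_compose g_continuous _.
  have c1 : continuous (fun x : W * R * I01 R => x.1).
    exact: continuous_fst.
  apply: continuous_pair.
    exact: continuous_compose (@continuous_fst _ _) c1.
  apply: continuous_addr.
    exact: continuous_compose (@continuous_snd _ _) c1.
  apply: continuous_mulr; first exact: continuous_const.
  by apply: continuous_compose; [exact: continuous_val|exact: continuous_snd].
- by move=> p; apply: v0.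
Qed.

Let step_ge0 k d p : 0 <= d -> 0 <= step k d p.
Proof. by move=> d0; rewrite /step le_min d0 le_max lexx. Qed.

Let step_le k d p : step k d p <= d.
Proof. by rewrite /step ge_min lexx. Qed.

Let has_lbound_v k (d : R) (p : W * R) :
  has_lbound (range (fun s : I01 R => v k (g (p.1, p.2 + d * val s)))).
Proof. by case: vtr => _ v0 _ _; exists 0 => _ [s _ <-]. Qed.

Let step_pos k d w t s : 0 < d -> 0 < step k d (w, t) ->
  t <= s -> s <= t + d -> 0 < v k (g (w, s)).
Proof.
move=> d0; rewrite /step lt_min d0 lt_max ltxx /= => h ts st.
have s0 : 0 <= (s - t) / d by rewrite divr_ge0 ?subr_ge0 // ltW.
have s1 : (s - t) / d <= 1 by rewrite ler_pdivrMr // mul1r; lra.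
have := ge_inf (has_lbound_v k d (w, t)) (imageT _ (clamp ((s - t) / d))).
rewrite [val (clamp _)]val_clamp // mulrC divfK ?gt_eqF //=.
by rewrite [t + (s - t)]addrC subrK; lra.
Qed.

Let step_eq0 k d w t : 0 < d -> v k (g (w, t)) < d -> step k d (w, t) = 0.
Proof.
move=> d0 vd; have := ge_inf (has_lbound_v k d (w, t)) (imageT _ (I01_0 R)).
rewrite /= mulr0 addr0 => h.
by rewrite /step max_l ?min_r //; [exact: ltW|move: h vd => /=; lra].
Qed.

Let step_full k d w t : 0 < d ->
  (forall s, t <= s <= t + d -> 2 * d <= v k (g (w, s))) -> step k d (w, t) = d.
Proof.
move=> d0 h.
have le : 2 * d <= inf (range (fun s : I01 R => v k (g (w, t + d * val s)))).
  apply: lb_le_inf; first by exists (v k (g (w, t + d * val (I01_0 R)))), (I01_0 R).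
  move=> _ [s _ <-]; apply: h; have /andP[s0 s1] := I01P s.
  by rewrite lerDl mulr_ge0 ?(ltW d0) //= lerD2l ler_piMr // ltW.
by rewrite /step min_l // le_max; apply/orP; right => /=; lra.
Qed.

(* The discarded third component of the code makes every pair recur. *)
Let idx (n : nat) : nat * nat :=
  if (unpickle n : option ((nat * nat) * nat)) is Some p then p.1 else (0, 0)%N.

Let idx_infinitely_often (kN : nat * nat) (m : nat) :
  exists2 n, (m <= n)%N & idx n = kN.
Proof.
apply: contrapT => H.
pose code (i : nat) : nat := @pickle (nat * nat * nat)%type (kN, i).
have inj : injective code by move=> i j /(pcan_inj (@pickleK _)) [].
have lt i : (code i < m)%N.
  rewrite ltnNge; apply/negP => le; apply: H; exists (code i) => //.
  by rewrite /idx pickleK.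
pose h (i : 'I_m.+1) : 'I_m := Ordinal (lt i).
have /leq_card : injective h by move=> i j ij; apply/val_inj/inj; have [] := ij.
by rewrite !card_ord ltnn.
Qed.

Let d (n : nat) : R := (idx n).2.+1%:R^-1.

Let d_gt0 n : 0 < d n. Proof. by rewrite /d invr_gt0 ltr0Sn. Qed.

Fixpoint lift_time (n : nat) (w : W) : R :=
  if n is m.+1 then
    lift_time m w + step (idx m).1 (d m) (w, lift_time m w)
  else 0.

(** The same formula extends the lift and keeps what is already lifted: for
    [t <= lift_time m w] the second argument of [tr] is the image of the first. *)
Fixpoint partial_lift (n : nat) (p : W * R) : E :=
  if n is m.+1 then
    tr (idx m).1 (partial_lift m p, g (p.1, Num.min p.2 (lift_time m.+1 p.1)))
  else f p.1.

Let lift_time_continuous n : continuous (lift_time n).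
Proof.
elim: n => [|n IH] /=; first exact: continuous_const.
apply: continuous_addr => //; apply: continuous_compose; first exact: step_continuous.
by apply: continuous_pair => //; exact: continuous_id.
Qed.

Let lift_time_homo w : {homo lift_time^~ w : m n / (m <= n)%N >-> m <= n}.
Proof.
by apply: homo_leq => [//|y x z /le_trans|n /=]; [apply|rewrite lerDl step_ge0 // ltW].
Qed.

Let lift_time_ge0 n w : 0 <= lift_time n w.
Proof. exact: (lift_time_homo w (leq0n n)). Qed.

Let partial_lift_over n w t :
  q (partial_lift n (w, t)) = g (w, Num.min t (lift_time n w)).
Proof.
case: n => [|n] /=; last by case: vtr => _ _ _ /(_ (idx n).1) [].
by rewrite /g /= clamp_le0 ?qf // ge_min lexx orbT.
Qed.

Let partial_lift_stable n w t :
  Num.min t (lift_time n.+1 w) = Num.min t (lift_time n w) ->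
  partial_lift n.+1 (w, t) = partial_lift n (w, t).
Proof.
move=> h; rewrite [LHS]/= -/(lift_time n.+1 w) h -partial_lift_over.
by case: vtr => _ _ _ /(_ (idx n).1) [].
Qed.

(** The only doubtful points are those where the new piece starts; there
    either the step vanishes nearby and nothing is added, or the whole piece lies
    inside the trivialisation. *)
Let partial_lift_continuous n : continuous (partial_lift n).
Proof.
case: vtr => vc _ _ trP.
have cT m : continuous (fun p : W * R => lift_time m p.1).
  by apply: continuous_compose => //; exact: continuous_fst.
elim: n => [|n IH]; first exact: continuous_compose fc (@continuous_fst _ _).
move=> [w t]; have [ck ok ik] := trP (idx n).1.
set k := (idx n).1 in ck ok ik *.
have cvT : continuous (fun p : W * R => v k (g (p.1, lift_time n p.1))).
  apply: continuous_compose (vc k) _; apply: continuous_compose g_continuous _.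
  by apply: continuous_pair => //; exact: continuous_fst.
have [small|large] := ltP (v k (g (w, lift_time n w))) (d n).
  apply: (@near_eq_continuous_at _ _ _ (partial_lift n)); last exact: IH.
  have : \forall p \near (w, t), v k (g (p.1, lift_time n p.1)) < d n.
    exact: (near_lt_continuous cvT).
  apply: filterS => -[w' t'] /= small'.
  apply: partial_lift_stable => /=.
  by rewrite -/k step_eq0 ?addr0.
have [tlt|let_] := ltP t (lift_time n w).
  apply: (@near_eq_continuous_at _ _ _ (partial_lift n)); last exact: IH.
  have cd : continuous (fun p : W * R => lift_time n p.1 - p.2).
    by apply: continuous_subr => //; exact: continuous_snd.
  have : \forall p \near (w, t), 0 < lift_time n p.1 - p.2.
    by apply: (near_gt_continuous cd); rewrite subr_gt0.
  apply: filterS => -[w' t'] /=; rewrite subr_gt0 => lt'.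
  have lt2 := lift_time_homo w' (leqnSn n).
  apply: partial_lift_stable; rewrite min_l ?min_l ?(ltW lt') //.
  exact: le_trans (ltW lt') lt2.
have pos1 : 0 < v k (q (partial_lift n (w, t))).
  by rewrite partial_lift_over min_r // (lt_le_trans _ large).
have pos2 : 0 < v k (g (w, Num.min t (lift_time n.+1 w))).
  have [s0|s0] := eqVneq (step k (d n) (w, lift_time n w)) 0.
    by rewrite /= -/k s0 addr0 min_r // (lt_le_trans _ large).
  apply: (@step_pos k (d n) w (lift_time n w)) => //.
  - by rewrite lt_neqAle eq_sym s0 step_ge0 // ltW.
  - by rewrite le_min let_ (lift_time_homo w (leqnSn n)).
  - by rewrite ge_min /= -/k lerD2l step_le orbT.
apply: (@continuous_comp _ _ _ (fun p => (partial_lift n p,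
  g (p.1, Num.min p.2 (lift_time n.+1 p.1)))) (tr k)); last exact: ck.
apply: cvg_pair; first exact: IH.
have c2 : continuous (fun p : W * R => g (p.1, Num.min p.2 (lift_time n.+1 p.1))).
  apply: continuous_compose g_continuous _; apply: continuous_pair.
    exact: continuous_fst.
  by apply: continuous_minr => //; exact: continuous_snd.
exact: c2.
Qed.

(** If they stayed bounded, the times would converge to some [s]. A pair
    [(k, N)] such that [v k] is large compared with [1 / N.+1] near [s] occurs
    infinitely often, and each late enough occurrence would advance the time by
    [1 / N.+1]. *)
Let lift_time_unbounded w : exists n, 1 < lift_time n w.
Proof.
case: vtr => vc _ vpos _; apply: contrapT => H.
have le1 n : lift_time n w <= 1.
  by rewrite leNgt; apply/negP => lt; apply: H; exists n.
pose A := range (lift_time^~ w); pose s := sup A.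
have hA : has_sup A by split; [exists (lift_time 0 w), 0%N|exists 1 => _ [n _ <-]].
have les n : lift_time n w <= s by apply: sup_ubound; [case: hA|exists n].
have [k vk] := vpos (g (w, s)).
pose c := v k (g (w, s)) / 2; have c0 : 0 < c by rewrite divr_gt0.
have cvt : continuous (fun t : R => v k (g (w, t))).
  apply: continuous_compose (vc k) _; apply: continuous_compose g_continuous _.
  by apply: continuous_pair; [exact: continuous_const|exact: continuous_id].
have : \forall t \near s, c < v k (g (w, t)).
  by apply: (near_gt_continuous cvt); rewrite /c; lra.
move=> /nbhs_ballP [eta /= eta0 etaP].
have [N Nlt] : exists N : nat, N.+1%:R^-1 < Num.min (eta / 2) (c / 2).
  have m0 : 0 < Num.min (eta / 2) (c / 2) by rewrite lt_min !divr_gt0.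
  have [N _ HN] := near_infty_natSinv_lt (PosNum m0).
  by exists N; apply: HN => /=.
move: Nlt; rewrite lt_min => /andP[N1 N2].
set e := N.+1%:R^-1 in N1 N2; have e0 : 0 < e by rewrite invr_gt0 ltr0Sn.
have [_ [m _ <-] mlt] := sup_adherent e0 hA.
have [n mn idxn] := idx_infinitely_often (k, N) m.
have nlt : s - e < lift_time n w := lt_le_trans mlt (lift_time_homo w mn).
have dn : d n = e by rewrite /d idxn.
have := les n.+1; rewrite /= idxn dn step_full //; first lra.
move=> t /andP[t1 t2]; apply: le_trans (ltW (etaP t _)); first lra.
have := les n; rewrite /ball /= => ?; rewrite ltr_norml; lra.
Qed.

(** Lift [gamma] piece by piece, for all [w] at once: the [n]-th piece
    covers the times from [lift_time n w] to [lift_time n.+1 w] and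
    uses one fixed trivialisation. The times are continuous in [w] and pass
    [1] after finitely many steps, so that near each [w] the
    lift is a finite concatenation. *)
Theorem covering_homotopy : exists Gamma : W * I01 R -> E,
  [/\ continuous Gamma, forall w, Gamma (w, I01_0 R) = f w
    & forall p, q (Gamma p) = gamma p].
Proof.
have [N NP] := choice lift_time_unbounded.
have stable n w t : 1 < lift_time n w -> t <= 1 -> forall m, (n <= m)%N ->
    partial_lift m (w, t) = partial_lift n (w, t).
  move=> nw t1 m nm; rewrite -(subnKC nm); elim: (m - n)%N => [|i IH].
    by rewrite addn0.
  have le j : t <= lift_time (n + j) w.
    exact: le_trans t1 (le_trans (ltW nw) (lift_time_homo w (leq_addr j n))).
  by rewrite addnS partial_lift_stable ?IH // min_l ?min_l -?addnS.
pose Gamma (p : W * I01 R) := partial_lift (N p.1) (p.1, val p.2).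
have GammaE n w (t : I01 R) : 1 < lift_time n w ->
    Gamma (w, t) = partial_lift n (w, val t).
  move=> nw; have /andP[_ t1] := I01P t; rewrite /Gamma /=.
  rewrite -(stable (N w) w (val t) (NP w) t1 (maxn n (N w)) (leq_maxr _ _)).
  exact: (stable n w (val t) nw t1 (maxn n (N w)) (leq_maxl _ _)).
exists Gamma; split.
- move=> [w t]; pose n := N w.
  have c1 : continuous (fun p : W * I01 R => lift_time n p.1).
    by apply: continuous_compose => //; exact: continuous_fst.
  have c2 : continuous (fun p : W * I01 R => partial_lift n (p.1, val p.2)).
    apply: continuous_compose => //; apply: continuous_pair.
      exact: continuous_fst.
    by apply: continuous_compose; [exact: continuous_val|exact: continuous_snd].
  apply: near_eq_continuous_at; last exact: c2.
  have : \forall p \near (w, t), 1 < lift_time n p.1.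
    by apply: (near_gt_continuous c1); exact: NP.
  by apply: filterS => -[w' t'] /= /GammaE.
- move=> w; rewrite /Gamma /=; elim: (N w) => [//|n IH].
  rewrite partial_lift_stable // min_l ?min_l ?lift_time_ge0 //.
- move=> [w t]; rewrite /Gamma partial_lift_over /g /=.
  have /andP[_ t1] := I01P t.
  by rewrite min_l ?clampK // (le_trans t1 (ltW (NP w))).
Qed.

End CoveringHomotopy.

Lemma near_finite_set (T : Type) (I : choiceType) (A : set I) (P : I -> T -> Prop)
    (F : set_system T) :
  Filter F -> finite_set A -> (forall i, A i -> \forall x \near F, P i x) ->
  \forall x \near F, forall i, A i -> P i x.
Proof.
move=> FF /finite_fsetP [D ->] PF.
by have := @filter_bigI T I D P F FF PF; apply: filterS => x H i /H.
Qed.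

(** * Principal actions *)

Section Actions.
Variables (R : realType) (G : topologicalGroupType).
Variables (E : topologicalType) (act : G -> E -> E).
Hypothesis actP : continuous_action act.

Local Notation q := (orbit_proj act).

Lemma orbit_projP (x y : E) : q x = q y <-> exists g, y = act g x.
Proof.
case: actP => act1 actM _; split; last first.
  by move=> [g yg]; apply/quotient_projP; apply: rst_step; exists g.
move=> /quotient_projP; elim=> [a b //|a|a b _ [g ->]|a b c _ [g ->] _ [h ->]].
- by exists 1%g; rewrite act1.
- by exists (g^-1)%g; rewrite -actM mulVg act1.
- by exists (h * g)%g; rewrite actM.
Qed.

Lemma orbit_proj_act (g : G) (x : E) : q (act g x) = q x.
Proof. by apply/esym/orbit_projP; exists g. Qed.

Lemma orbit_proj_continuous : continuous q.
Proof. exact: quotient_proj_continuous. Qed.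

Lemma act_continuous (g : G) : continuous (act g).
Proof.
case: actP => _ _ actc.
apply: (@continuous_compose _ _ _ (fun p : G * E => act p.1 p.2) (pair g) actc).
by apply: continuous_pair; [exact: continuous_const|exact: continuous_id].
Qed.

Lemma continuous_act (X : topologicalType) (a : X -> G) (f : X -> E) :
  continuous a -> continuous f -> continuous (fun x => act (a x) (f x)).
Proof.
case: actP => _ _ actc ca cf.
exact: (@continuous_compose _ _ _ (fun p : G * E => act p.1 p.2) _ actc (continuous_pair ca cf)).
Qed.

Lemma orbit_proj_open (A : set E) : open A -> open (q @` A).
Proof.
move=> oA; suff : open (q @^-1` (q @` A)) by [].
have -> : q @^-1` (q @` A) = \bigcup_(g in setT) (act g @^-1` A).
  apply/seteqP; split=> [x [y Ay /esym/orbit_projP [g yg]]|x [g _ Agx]].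
    by exists g => //=; rewrite -yg.
  by exists (act g x) => //; rewrite orbit_proj_act.
by apply: bigcup_open => g _; move/continuousP: (@act_continuous g); apply.
Qed.

Lemma orbit_proj_nbhs (x : E) (A : set E) : nbhs x A -> nbhs (q x) (q @` A).
Proof.
rewrite !nbhsE => -[U [oU Ux] UA]; exists (q @` U); last exact: image_subset.
by split; [exact: orbit_proj_open|exists x].
Qed.

(** Only the equivariant coordinate [tau k] of each trivialisation is kept: the
    corresponding section is recovered from [tau k] and the action, since
    [orbit_proj] is open. *)
Definition countable_trivialization (v : nat -> orbit_space act -> R)
    (tau : nat -> E -> G) : Prop :=
  [/\ forall k, continuous (v k),
      forall k b, 0 <= v k b,
      forall b, exists k, 0 < v k b
    & forall k e, 0 < v k (q e) ->
        {for e, continuous (tau k)} /\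
        forall g, tau k (act g e) = (g * tau k e)%g].

Section Numerable.
Variables (I : choiceType) (u : I -> orbit_space act -> R).
Hypothesis uc : forall i, continuous (u i).
Hypothesis u0 : forall i b, 0 <= u i b.
Hypothesis ufin : forall b : orbit_space act, exists2 N : set (orbit_space act),
  nbhs b N & finite_set [set i | exists2 y, N y & u i y != 0].

Lemma locally_finite_near (b : orbit_space act) (e : R) : 0 < e ->
  \forall b' \near b, forall i, `|u i b' - u i b| <= e.
Proof.
move=> e0; have [N Nb fin] := ufin b.
have near_D : \forall b' \near b, forall i, (exists2 y, N y & u i y != 0) ->
    `|u i b' - u i b| <= e.
  apply: (@near_finite_set _ _ _ (fun i b' => `|u i b' - u i b| <= e) (nbhs b) _ fin) => i _.
  have /cvgrPdist_le/(_ _ e0) := @uc i b.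
  by apply: filterS => b' /=; rewrite distrC.
have Nb0 : N b := nbhs_singleton Nb.
apply: filterS2 Nb near_D => b' Nb' H i.
have [|iD] := pselect (exists2 y, N y & u i y != 0); first exact: H.
have z y : N y -> u i y = 0.
  by move=> Ny; apply: contrapT => uy; apply: iD; exists y => //; exact/eqP.
by rewrite !z // subrr normr0 ltW.
Qed.

Variable eps : nat -> R.
Hypothesis eps_gt0 : forall k, 0 < eps k.
Hypothesis eps_small : forall x, 0 < x -> \forall k \near \oo, eps k < x.

(* [level k b] is positive iff [eps k] keeps a positive distance from all
   [u i b] and is below some [u i b]. Where this holds, the set of
   [i] with [u i b] above [eps k] is locally constant, so that one
   trivialisation can be chosen as a function of this set. *)
Let gap (k : nat) (b : orbit_space act) : R := inf (range (fun i => `|u i b - eps k|)).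
Let below (k : nat) (b : orbit_space act) : R :=
  inf (range (fun i => Num.max (-1) (eps k - u i b))).
Let level (k : nat) (b : orbit_space act) : R :=
  Num.max 0 (Num.min (gap k b) (- below k b)).

Variable i0 : I.

Let level_continuous k : continuous (level k).
Proof.
apply: continuous_maxr; first exact: continuous_const.
have cg : continuous (gap k).
  move=> b; apply: (@inf_range_continuous_at R I i0 _ _ 0) => // e e0.
  apply: filterS (locally_finite_near b e0) => b' H i.
  by apply: le_trans (H i); apply: le_trans (ler_dist_dist _ _) _; rewrite opprB addrA subrK.
have cb : continuous (below k).
  move=> b; apply: (@inf_range_continuous_at R I i0 _ _ (-1)) => [b' i|e e0].
    by rewrite le_max lexx.
  apply: filterS (locally_finite_near b e0) => b' H i; have := H i.
  by rewrite !ler_norml /Num.max; case: ifP => //; case: ifP => // *; lra.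
apply: continuous_minr => //.
by move=> b; exact: (cvgN (cb b)).
Qed.

Let level_gt0 k b : 0 < level k b -> 0 < gap k b /\ exists i, eps k < u i b.
Proof.
rewrite /level lt_max ltxx lt_min => /andP[g0]; rewrite (oppr_gt0 (below k b)) => b0; split=> //.
apply: contrapT => H; move: b0; rewrite ltNge => /negP; apply.
rewrite /below; apply: lb_le_inf; first by exists (Num.max (-1) (eps k - u i0 b)), i0.
move=> _ [i _ <-]; rewrite le_max subr_ge0; apply/orP; right.
by rewrite leNgt; apply/negP => lt; apply: H; exists i.
Qed.

Let level_cover b : (exists i, u i b != 0) -> exists k, 0 < level k b.
Proof.
move=> [i ui]; have [N Nb fin] := ufin b.
have : \forall k \near \oo, forall j, u j b != 0 -> 2 * eps k < u j b.
  have sub : [set j | u j b != 0] `<=` [set j | exists2 y, N y & u j y != 0].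
    by move=> j uj; exists b => //; exact: nbhs_singleton.
  apply: (@near_finite_set _ _ _ (fun j k => 2 * eps k < u j b) \oo _ (sub_finite_set sub fin)) => j uj.
  have uj0 : 0 < u j b / 2 by rewrite divr_gt0 // lt_neqAle eq_sym uj u0.
  have := eps_small uj0; apply: filterS => k h.
  by rewrite mulrC -ltr_pdivlMr.
move=> /filter_ex [k Hk]; exists k.
have uE j : u j b = 0 \/ 2 * eps k < u j b.
  by have [|uj] := eqVneq (u j b) 0; [left|right; exact: Hk].
have ek := eps_gt0 k.
rewrite /level lt_max lt_min; apply/orP; right; apply/andP; split.
  apply: (lt_le_trans (eps_gt0 k)); rewrite /gap; apply: lb_le_inf; first by exists (`|u i0 b - eps k|), i0.
  move=> _ [j _ <-]; have [->|lt] := uE j; first by rewrite sub0r normrN gtr0_norm.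
  by rewrite ger0_norm; lra.
have [ui0|lt] := uE i; first by rewrite ui0 eqxx in ui.
rewrite (oppr_gt0 (below k b)); apply: (@le_lt_trans _ _ (Num.max (-1) (eps k - u i b))).
  by rewrite /below; apply: ge_inf; [exists (-1) => _ [j _ <-]; rewrite le_max lexx|exists i].
by rewrite gt_max; apply/andP; split; lra.
Qed.

Let index (k : nat) (b : orbit_space act) : I := xget i0 [set i | eps k < u i b].

Let indexP k b : 0 < level k b -> eps k < u (index k b) b.
Proof.
by move=> /level_gt0 [_ [i ui]]; rewrite /index; case: xgetP => [j _ //|/(_ i)].
Qed.

Let index_near k b : 0 < level k b -> \forall b' \near b, index k b' = index k b.
Proof.
move=> /level_gt0 [g0 _].
have g2 : 0 < gap k b / 2 by rewrite divr_gt0.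
apply: filterS (locally_finite_near b g2) => b' H.
rewrite /index; congr (xget _ _); apply/funext => i; apply/propext.
have : gap k b <= `|u i b - eps k|.
  by rewrite /gap; apply: ge_inf; [exists 0 => _ [j _ <-]|exists i].
have := H i; rewrite ler_norml => /andP[h1 h2].
case: (ltP (eps k) (u i b)) => h.
  rewrite ger0_norm ?subr_ge0 ?(ltW h) // => h3.
  by split=> _ /=; lra.
rewrite ler0_norm ?subr_le0 // => h3.
by split=> /=; lra.
Qed.

Variable (tau : I -> E -> G).
Hypothesis tauP : forall i e, u i (q e) != 0 ->
  {for e, continuous (tau i)} /\ forall g, tau i (act g e) = (g * tau i e)%g.
Hypothesis ucover : forall b, exists i, u i b != 0.

Lemma countable_trivialization_of_partition :
  exists v t, countable_trivialization v t.
Proof.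
exists level, (fun k e => tau (index k (q e)) e); split.
- exact: level_continuous.
- by move=> k b; rewrite /level le_max lexx.
- by move=> b; exact: level_cover.
- move=> k e lv; have lt := indexP lv.
  have [|tc te] := @tauP (index k (q e)) e.
    by rewrite gt_eqF // (lt_trans (eps_gt0 k) lt).
  split; last by move=> g; rewrite orbit_proj_act te.
  apply: near_eq_continuous_at; last exact: tc.
  have : \forall e' \near e, index k (q e') = index k (q e).
    exact: orbit_proj_continuous (index_near lv).
  by apply: filterS => e' /= ->.
Qed.

End Numerable.

(** [E] is taken inhabited so that the index set of the cover is. *)
Lemma numerable_countable_trivialization (e0 : E) :
  numerable_principal R act -> exists v t, countable_trivialization v t.
Proof.
move=> [I [U [oU [u [uc u0 ufin u1 usupp]] triv]]].
have uU i b : u i b != 0 -> U i b by move=> ub; apply: usupp; exact: subset_closure.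
have ucover b : exists i, u i b != 0.
  apply: contrapT => H; have := u1 b; rewrite fsbig1 => [/esym/eqP|i _].
    by rewrite oner_eq0.
  by apply: contrapT => ui; apply: H; exists i; apply/eqP.
have [i0 _] := ucover (q e0).
have : forall i, exists t : E -> G, forall e, u i (q e) != 0 ->
    {for e, continuous t} /\ forall g, t (act g e) = (g * t e)%g.
  move=> i; have [t [s [tc _ te _ _]]] := triv i.
  exists t => e /uU Ue; split; last by move=> g; exact: te.
  have oUi : open (q @^-1` U i) by move/continuousP: orbit_proj_continuous; apply.
  move: tc; rewrite continuous_open_subspace // => /(_ e); apply.
  exact/mem_set.
move=> /choice [t tP].
pose eps (k : nat) : R := k.+1%:R^-1.
apply: (@countable_trivialization_of_partition _ _ uc u0 ufin eps _ _ i0 t tP ucover).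
  by move=> k; rewrite invr_gt0 ltr0Sn.
by move=> x x0; exact: (near_infty_natSinv_lt (PosNum x0)).
Qed.

Section Trivialized.
Variables (v : nat -> orbit_space act -> R) (tau : nat -> E -> G).
Hypothesis triv : countable_trivialization v tau.

Lemma continuous_at_group_div (X : topologicalType) (a b : X -> G) (x : X) :
  {for x, continuous a} -> {for x, continuous b} ->
  {for x, continuous (fun x => (a x * (b x)^-1)%g)}.
Proof.
move=> ca cb.
have cb' : {for x, continuous (fun x => (b x)^-1%g)}.
  by apply: (continuous_comp cb); exact: invg_continuous.
apply: (@continuous_comp _ _ _ (fun x => (a x, (b x)^-1%g)) (fun p : G * G => (p.1 * p.2)%g)).
  by apply: cvg_pair; [exact: ca|exact: cb'].
exact: mulg_continuous.
Qed.

Let open_v k : open [set e | 0 < v k (q e)].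
Proof.
case: triv => vc _ _ _.
have c : continuous (fun e => v k (q e)).
  by apply: continuous_compose (vc k) _; exact: orbit_proj_continuous.
by rewrite openE => e /= ve; exact: (near_gt_continuous c ve).
Qed.

(** In the trivialisation, [act (tau k e * (tau k e')^-1) e'] is the point of the
    fibre of [e'] with the coordinate of [e]. It depends only on the orbit
    of [e'], and openness of the orbit map makes it continuous in
    that orbit. *)
Lemma countable_trivialization_transport :
  exists tr, local_transport q v tr.
Proof.
case: (triv) (actP) => vc v0 vcover tauP [act1 actM _].
pose m k (p : E * E) := act (tau k p.1 * (tau k p.2)^-1)%g p.2.
pose tr k (p : E * orbit_space act) :=
  if `[< q p.1 = p.2 >] then p.1 else m k (p.1, quotient_repr p.2).
have reprK b : q (quotient_repr b) = b by exact: quotient_reprK.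
have mE k e e' : 0 < v k (q e') -> m k (e, e') = tr k (e, q e').
  move=> ve'; rewrite /tr /=; case: asboolP => [ee'|_].
    have /orbit_projP [g eg] := esym ee'; rewrite eg /m /=.
    by have [_ ->] := tauP _ _ ve'; rewrite mulgK.
  have /esym/orbit_projP [g e'g] := reprK (q e').
  rewrite e'g /m /=; have [_ ->] := tauP _ _ ve'.
  by rewrite invgM -actM mulgA mulgVK.
exists tr; split=> // k; split.
- move=> e b; rewrite -(reprK b); set e' := quotient_repr b => ve ve'.
  have cm : {for (e, e'), continuous (m k)}.
    have c1 : {for (e, e'), continuous (fun p : E * E => tau k p.1)}.
      apply: (@continuous_comp _ _ _ fst (tau k)); first exact: cvg_fst.
      by have [] := tauP _ _ ve.
    have c2 : {for (e, e'), continuous (fun p : E * E => tau k p.2)}.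
      apply: (@continuous_comp _ _ _ snd (tau k)); first exact: cvg_snd.
      by have [] := tauP _ _ ve'.
    have c3 := continuous_at_group_div c1 c2.
    apply: (@continuous_comp _ _ _ (fun p : E * E => ((tau k p.1 * (tau k p.2)^-1)%g, p.2))
      (fun p : G * E => act p.1 p.2)).
      by apply: cvg_pair; [exact: c3|exact: cvg_snd].
    by case: actP => _ _; apply.
  move=> A; rewrite /= -mE // => /cm [[P Q] /= [Pe Qe'] PQ].
  exists (P, q @` (Q `&` [set e | 0 < v k (q e)])).
    split=> //=; apply: orbit_proj_nbhs; apply: filterI => //.
    exact: (open_nbhs_nbhs (conj (open_v k) ve')).
  move=> [x _] /= [Px [y [Qy vy] <-]] /=; rewrite -mE //.
  exact: (PQ (x, y)).
- move=> e b; rewrite /tr /=; case: asboolP => [//|_].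
  by rewrite /m /= orbit_proj_act reprK.
- by move=> e; rewrite /tr /=; case: asboolP.
Qed.

(** In a trivialisation, the element that moves [a x] to [b x] is the quotient of
    their coordinates. *)
Lemma translation_continuous (X : topologicalType) (a b : X -> E) :
  continuous a -> continuous b ->
  (forall x, q (a x) = q (b x)) ->
  exists theta : X -> G, continuous theta /\ forall x, act (theta x) (a x) = b x.
Proof.
case: (triv) (actP) => vc v0 vcover tauP [act1 actM _] ca cb qab.
have [theta thetaP] := choice (fun x => (orbit_projP (a x) (b x)).1 (qab x)).
exists theta; split=> [x|x]; last by rewrite thetaP.
have [k vk] := vcover (q (a x)).
have near_v : \forall y \near x, 0 < v k (q (a y)).
  exact: (ca x _ (open_nbhs_nbhs (conj (@open_v k) vk))).
apply: (@near_eq_continuous_at _ _ _ (fun y => (tau k (b y) * (tau k (a y))^-1)%g)).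
  apply: filterS near_v => y vy; rewrite [b y]thetaP.
  by have [_ ->] := tauP _ _ vy; rewrite mulgK.
have [ta _] := tauP _ _ vk.
have vb : 0 < v k (q (b x)) by rewrite -qab.
have [tb _] := tauP _ _ vb.
by apply: continuous_at_group_div;
  [apply: (continuous_comp (cb x))|apply: (continuous_comp (ca x))].
Qed.

End Trivialized.
End Actions.

(** * Lie groups and the cone on a coset space *)

Lemma hausdorff_locally_compact_regular (X : topologicalType) :
  hausdorff_space X -> locally_compact [set: X] -> regular_space X.
Proof.
move=> hX lX x; have [B] := lX x I; rewrite withinET => Bx [cB _].
exact: compact_regular cB Bx.
Qed.

(** Charts carry closed balls of the model space to compact neighbourhoods. *)
Lemma lie_group_locally_compact (R : realType) (G : topologicalGroupType) :
  lie_group R G -> locally_compact [set: G].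
Proof.
move=> [hG _ [n [A [[Acov _] _ _]]]] x _; rewrite withinET.
have [a _ ax] := Acov x.
have oimg := @chart_img_open _ _ _ a.
have imgx : (chart_map a @` chart_dom a) (chart_map a x) by exists x.
have [r r0 rimg] : exists2 r : R, 0 < r &
    closed_ball (chart_map a x) r `<=` chart_map a @` chart_dom a.
  have /nbhs_closedballP [r rP] := open_nbhs_nbhs (conj oimg imgx).
  by exists r%:num.
set C := closed_ball (chart_map a x) r in rimg.
have cC : compact C.
  apply: bounded_closed_compact; last exact: closed_ball_closed.
  exists (`|chart_map a x| + r); split; first exact: num_real.
  move=> M lt y; rewrite /C closed_ballE // /closed_ball_ /= => dy.
  apply: le_trans (ltW lt); rewrite -(subKr (chart_map a x) y).
  by apply: le_trans (ler_normB _ _) _; rewrite lerD2l.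
have cD : compact (chart_inv a @` C).
  apply: continuous_compact => //.
  exact: continuous_subspaceW rimg (@chart_inv_continuous _ _ _ a).
exists (chart_inv a @` C); last by split=> //; exact: compact_closed.
have cx : {for x, continuous (chart_map a)}.
  have := @chart_map_continuous _ _ _ a.
  rewrite continuous_open_subspace; last exact: chart_dom_open.
  by apply; exact/mem_set.
have near_dom : nbhs x (chart_dom a).
  by apply: open_nbhs_nbhs; split=> //; exact: chart_dom_open.
have near_C : nbhs x (chart_map a @^-1` C).
  by apply: cx; apply: filterS (nbhsx_ballx _ _ r0); exact: subset_closed_ball.
apply: filterS2 near_dom near_C => y ay Cy.
by exists (chart_map a y) => //; exact: chart_mapK.
Qed.

Section QuotientAction.
Variables (G : topologicalGroupType).
Hypotheses (lG : locally_compact [set: G]) (rG : regular_space G).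

(** Local compactness of the group is what makes the induced action jointly
    continuous when the projection of [T] onto its quotient is not open. *)
Lemma continuous_action_quotient (T : topologicalType) (E : relation T)
    (act : G -> T -> T) :
  continuous_action act ->
  (forall g a b, E a b -> clos_refl_sym_trans T E (act g a) (act g b)) ->
  continuous_action (fun g => @quotient_map T T E E (act g)).
Proof.
move=> [act1 actM actc] actE.
have qE g x : quotient_map E (act g) (quotient_proj E x) = quotient_proj E (act g x).
  by apply: quotient_mapE => a b; exact: actE.
split.
- by move=> x; rewrite -(quotient_reprK x) qE act1.
- by move=> g h x; rewrite -(quotient_reprK x) !qE actM.
- have c : continuous (fun p : quotient_space E * G => quotient_map E (act p.2) p.1).
    apply: quotient_prod_continuous => //=.
    have -> : (fun p : T * G => quotient_map E (act p.2) (quotient_proj E p.1)) =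
        (fun p : T * G => quotient_proj E (act p.2 p.1)).
      by apply/funext => p; exact: qE.
    apply: continuous_compose (@quotient_proj_continuous _ _) _.
    apply: (@continuous_compose _ _ _ (fun p : G * T => act p.1 p.2)
      (fun p : T * G => (p.2, p.1))) => //.
    by apply: continuous_pair; [exact: continuous_snd|exact: continuous_fst].
  apply: (@continuous_compose _ _ _ _ (fun p : G * quotient_space E => (p.2, p.1))) c _.
  by apply: continuous_pair; [exact: continuous_snd|exact: continuous_fst].
Qed.

Lemma continuous_action_cosets (H : set G) :
  continuous_action (@coset_action G H).
Proof.
apply: (@continuous_action_quotient G (coset_rel H) (fun g x => (g * x)%g)).
  split; [exact: mul1g|by move=> *; rewrite mulgA|exact: mulg_continuous].
move=> g a b ab; apply: rst_step.
by rewrite /coset_rel invgM -mulgA mulKg.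
Qed.

Lemma continuous_action_cone (R : realType) (Y : topologicalType) (act : G -> Y -> Y) :
  continuous_action act -> continuous_action (cone_action (R := R) act).
Proof.
move=> [act1 actM actc].
apply: (@continuous_action_quotient (Y * I01 R)%type (@cone_rel R Y)
  (fun g p => (act g p.1, p.2))).
  split=> [[y t]|g h [y t]|] /=; [by rewrite act1|by rewrite actM|].
  have c2 := @continuous_snd G (Y * I01 R)%type.
  apply: continuous_pair; last exact: continuous_compose (@continuous_snd _ _) c2.
  apply: (@continuous_compose _ _ _ (fun p : G * Y => act p.1 p.2)
    (fun p : G * (Y * I01 R) => (p.1, p.2.1))) => //.
  apply: continuous_pair; first exact: continuous_fst.
  exact: continuous_compose (@continuous_fst _ _) c2.
by move=> g a b ab; apply: rst_step.
Qed.

Lemma continuous_action_diag (X Y : topologicalType) (aX : G -> X -> X)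
    (aY : G -> Y -> Y) :
  continuous_action aX -> continuous_action aY ->
  continuous_action (diag_action aX aY).
Proof.
move=> aXP aYP; have [aX1 aXM aXc] := aXP; have [aY1 aYM aYc] := aYP.
split=> [[x y]|g h [x y]|]; rewrite /diag_action /=.
- by rewrite aX1 aY1.
- by rewrite aXM aYM.
- have c1 := @continuous_fst G (X * Y)%type.
  have c2 := @continuous_snd G (X * Y)%type.
  apply: continuous_pair; apply: continuous_act => //.
    exact: continuous_compose (@continuous_fst _ _) c2.
  exact: continuous_compose (@continuous_snd _ _) c2.
Qed.

End QuotientAction.

(** The contraction slides along the rays of the cone. Its continuity at the apex
    is not a local matter; it comes from [quotient_prod_continuous]. *)
Lemma contractible_cone (R : realType) (Y : topologicalType) (y0 : Y) :
  contractible R (cone R Y).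
Proof.
pose h (p : cone R Y * I01 R) : cone R Y :=
  quotient_map (@cone_rel R Y) (fun a : Y * I01 R => (a.1, clamp (val a.2 * (1 - val p.2)))) p.1.
have hE a s : h (quotient_proj (@cone_rel R Y) a, s) =
    quotient_proj (@cone_rel R Y) (a.1, clamp (val a.2 * (1 - val s))).
  apply: quotient_mapE => b c [b0 c0]; apply: rst_step.
  by split; rewrite /= ?b0 ?c0 mul0r clamp_le0.
exists (quotient_proj (@cone_rel R Y) (y0, I01_0 R)), h; split.
- apply: quotient_prod_continuous; [exact: I01_locally_compact|exact: I01_regular|].
  have -> : (fun p : Y * I01 R * I01 R => h (quotient_proj (@cone_rel R Y) p.1, p.2)) =
      (fun p : Y * I01 R * I01 R => quotient_proj (@cone_rel R Y)
         (p.1.1, clamp (val p.1.2 * (1 - val p.2)))).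
    by apply/funext => p; rewrite hE.
  apply: continuous_compose (@quotient_proj_continuous _ _) _.
  have c1 := @continuous_fst (Y * I01 R)%type (I01 R).
  apply: continuous_pair; first exact: continuous_compose (@continuous_fst _ _) c1.
  apply: continuous_compose (@clamp_continuous R) _; apply: continuous_mulr.
    apply: (continuous_compose (@continuous_val _ _)).
    exact: continuous_compose (@continuous_snd _ _) c1.
  apply: continuous_subr; first exact: continuous_const.
  by apply: (continuous_compose (@continuous_val _ _)); exact: continuous_snd.
- move=> x; rewrite -(quotient_reprK x) hE /= subr0 mulr1.
  by rewrite [clamp _]clampK -surjective_pairing.
- move=> x; rewrite -(quotient_reprK x) hE /= subrr mulr0 clamp_le0 //.
  by apply/quotient_projP; apply: rst_step.
Qed.

Lemma contractible_prod (R : realType) (X Y : topologicalType) :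
  contractible R X -> contractible R Y -> contractible R (X * Y)%type.
Proof.
move=> [x0 [h [hc h0 h1]]] [y0 [k [kc k0 k1]]].
exists (x0, y0), (fun p => (h (p.1.1, p.2), k (p.1.2, p.2))); split.
- have c1 := @continuous_fst (X * Y)%type (I01 R).
  have c2 := @continuous_snd (X * Y)%type (I01 R).
  apply: continuous_pair; apply: continuous_compose => //; apply: continuous_pair => //.
    exact: continuous_compose (@continuous_fst _ _) c1.
  exact: continuous_compose (@continuous_snd _ _) c1.
- by move=> [x y]; rewrite /= h0 k0.
- by move=> [x y]; rewrite /= h1 k1.
Qed.

Lemma countable_trivialization_pullback (R : realType) (G : topologicalGroupType)
    (E E' : topologicalType) (act : G -> E -> E) (act' : G -> E' -> E') (f : E' -> E) :
  continuous f -> (forall g x, f (act' g x) = act g (f x)) ->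
  (exists v t, @countable_trivialization R G E act v t) ->
  exists v t, @countable_trivialization R G E' act' v t.
Proof.
move=> fc fact [v [t [vc v0 vcov tP]]].
pose fbar : orbit_space act' -> orbit_space act := quotient_map (orbit_rel act) f.
have fbarE x : fbar (orbit_proj act' x) = orbit_proj act (f x).
  apply: quotient_mapE => a b [g ->]; apply: rst_step; exists g.
  exact: fact.
have fbarc : continuous fbar.
  apply: quotient_space_continuous.
  have -> : (fun x => fbar (quotient_proj (orbit_rel act') x)) =
      (fun x => orbit_proj act (f x)) by apply/funext => x; exact: fbarE.
  exact: continuous_compose (@quotient_proj_continuous _ _) fc.
exists (fun k b => v k (fbar b)), (fun k x => t k (f x)); split.
- by move=> k; apply: continuous_compose.
- by move=> k b; apply: v0.
- by move=> b; apply: vcov.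
- move=> k x; rewrite fbarE => /tP [tc te]; split.
    exact: (continuous_comp (fc x) tc).
  by move=> g; rewrite fact te.
Qed.

(** * Paths in contractible spaces and homotopy fibers *)

Section ContractiblePaths.
Variables (R : realType) (E : topologicalType).

(** A family [m e] of paths to [e] such that every family of paths to [e]
    deforms onto it relative to the endpoints. For a contraction [c], the
    path [m e (x, _)] runs along the track of [x] under [c] and then
    backwards along the track of [e]. A path [alpha] from [x] to [e] spans
    the square [c (alpha s, t)], in which [alpha] is the bottom side and [m e (x, _)]
    the rest of the boundary; the two are joined by straight lines in the square. *)
Lemma contractible_paths : contractible R E ->
  exists m : E -> E * I01 R -> E, forall e,
    [/\ continuous (m e), forall x, m e (x, I01_0 R) = x,
        forall x, m e (x, I01_1 R) = e
      & forall (W : topologicalType) (alpha : W * I01 R -> E),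
        continuous alpha -> (forall w, alpha (w, I01_1 R) = e) ->
        exists H : (W * I01 R) * I01 R -> E,
        [/\ continuous H,
            forall w s, H (w, I01_0 R, s) = m e (alpha (w, I01_0 R), s),
            forall w s, H (w, I01_1 R, s) = alpha (w, s),
            forall w u, H (w, u, I01_0 R) = alpha (w, I01_0 R)
          & forall w u, H (w, u, I01_1 R) = e]].
Proof.
move=> [x0 [c [cc c0 c1]]].
pose C (p : E * R) := c (p.1, clamp p.2).
have Cc : continuous C.
  apply: continuous_compose cc _; apply: continuous_pair; first exact: continuous_fst.
  apply: (continuous_compose (@clamp_continuous R)); exact: continuous_snd.
have C0 x t : t <= 0 -> C (x, t) = x by move=> t0; rewrite /C /= clamp_le0 ?c0.
have C1 x t : 1 <= t -> C (x, t) = x0 by move=> t1; rewrite /C /= clamp_ge1 ?c1.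
pose k (s : R) := Num.min (3 * s) (3 - 3 * s).
have kc : continuous k.
  have c3 : continuous (fun s : R => 3 * s).
    by apply: continuous_mulr; [exact: continuous_const|exact: continuous_id].
  by apply: continuous_minr => //; apply: continuous_subr => //; exact: continuous_const.
have k_ge1 s : 1 / 3 <= s -> s <= 2 / 3 -> 1 <= k s.
  by move=> h1 h2; rewrite /k le_min; apply/andP; split; lra.
pose m e (p : E * I01 R) :=
  if val p.2 <= 1 / 2 then C (p.1, k (val p.2)) else C (e, k (val p.2)).
exists m => e; split.
- have val2 : continuous (fun p : E * I01 R => val p.2).
    by apply: continuous_compose (@continuous_val _ _) _; exact: continuous_snd.
  have ck : continuous (fun p : E * I01 R => k (val p.2)).
    exact: continuous_compose kc val2.
  (* The two branches agree for [1 / 3 <= s <= 2 / 3]. *)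
  move=> [x s]; have [sle|slt] := leP (val s) (1 / 2).
    have sub : val s < 2 / 3 by lra.
    apply: (@near_eq_continuous_at _ _ _ (fun p : E * I01 R => C (p.1, k (val p.2)))).
      have := near_lt_continuous val2 (x := (x, s)) sub.
      apply: filterS => -[y t] /= t2; rewrite /m /=.
      case: ifPn => //; rewrite -ltNge => t1.
      by rewrite !C1 // k_ge1 //; lra.
    have cC : continuous (fun p : E * I01 R => C (p.1, k (val p.2))).
      by apply: continuous_compose Cc _; apply: continuous_pair => //; exact: continuous_fst.
    exact: cC.
  have sub : 1 / 3 < val s by lra.
  apply: (@near_eq_continuous_at _ _ _ (fun p : E * I01 R => C (e, k (val p.2)))).
    have := near_gt_continuous val2 (x := (x, s)) sub.
    apply: filterS => -[y t] /= t2; rewrite /m /=.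
    by case: ifPn => // t1; rewrite !C1 // k_ge1 //; lra.
  have cC : continuous (fun p : E * I01 R => C (e, k (val p.2))).
    by apply: continuous_compose Cc _; apply: continuous_pair => //; exact: continuous_const.
  exact: cC.
- by move=> x; rewrite /m /= ifT ?C0 // /k ?ge_min; lra.
- move=> x; rewrite /m /= ifF; last by apply/negbTE; rewrite -ltNge; lra.
  by rewrite C0 // /k ge_min; apply/orP; right; lra.
- move=> W alpha ac a1.
  pose aR (p : W * R) := alpha (p.1, clamp p.2).
  have aRc : continuous aR.
    apply: continuous_compose ac _; apply: continuous_pair; first exact: continuous_fst.
    by apply: (continuous_compose (@clamp_continuous R)); exact: continuous_snd.
  have a_le0 w t : t <= 0 -> aR (w, t) = alpha (w, I01_0 R).
    by move=> t0; rewrite /aR /= clamp_le0.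
  have a_ge1 w t : 1 <= t -> aR (w, t) = e by move=> t1; rewrite /aR /= clamp_ge1.
  pose H (p : (W * I01 R) * I01 R) : E :=
    let u := val p.1.2 in let s := val p.2 in
    C (aR (p.1.1, u * s + (1 - u) * (3 * s - 1)), (1 - u) * k s).
  exists H; split.
  + have cs : continuous (fun p : (W * I01 R) * I01 R => val p.2).
      by apply: continuous_compose (@continuous_val _ _) _; exact: continuous_snd.
    have c1' := @continuous_fst (W * I01 R)%type (I01 R).
    have cu : continuous (fun p : (W * I01 R) * I01 R => val p.1.2).
      apply: continuous_compose (@continuous_val _ _) _.
      exact: continuous_compose (@continuous_snd _ _) c1'.
    have cu1 : continuous (fun p : (W * I01 R) * I01 R => 1 - val p.1.2).
      by apply: continuous_subr => //; exact: continuous_const.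
    apply: continuous_compose Cc _; apply: continuous_pair.
      apply: continuous_compose aRc _; apply: continuous_pair.
        exact: continuous_compose (@continuous_fst _ _) c1'.
      apply: continuous_addr; apply: continuous_mulr => //.
      apply: continuous_subr; last exact: continuous_const.
      by apply: continuous_mulr => //; exact: continuous_const.
    by apply: continuous_mulr => //; exact: continuous_compose kc cs.
  + move=> w s; have /andP[s0 s1] := I01P s; rewrite /H /m /= -[sval s]/(val s).
    rewrite mul0r add0r subr0 !mul1r.
    case: ifPn => [sle|]; last rewrite -ltNge => slt.
      have [s3|s3] := leP (val s) (1 / 3); first by rewrite a_le0 //; lra.
      by rewrite !C1 // k_ge1 //; lra.
    have [s3|s3] := leP (val s) (2 / 3); last by rewrite a_ge1 //; lra.
    by rewrite !C1 // k_ge1 //; lra.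
  + move=> w s; rewrite /H /= mul1r subrr !mul0r addr0 C0 //.
    by rewrite /aR /= [clamp _]clampK.
  + move=> w u; have /andP[u0 u1] := I01P u; rewrite /H /= -[sval u]/(val u) C0.
      by rewrite a_le0 //; lra.
    rewrite /k mulr0 subr0 minEle ler0n mulr0; lra.
  + move=> w u; have /andP[u0 u1] := I01P u; rewrite /H /= -[sval u]/(val u) C0.
      by rewrite a_ge1 //; lra.
    by rewrite /k mulr1 subrr min_r ?ler0n // mulr0.
Qed.

End ContractiblePaths.

Section HomotopyFiber.
Variables (R : realType) (X B : topologicalType) (p : X -> B) (b : B).

Local Notation hofib := (set_type (@homotopy_fiber R X B p b)).

Lemma homotopy_fiberP (w : hofib) :
  [/\ continuous ((val w).2 : I01 R -> B), (val w).2 (I01_0 R) = p (val w).1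
    & (val w).2 (I01_1 R) = b].
Proof. exact: (set_valP w). Qed.

(** Evaluation of paths is continuous because the unit interval is locally
    compact and regular. *)
Lemma homotopy_fiber_eval_continuous :
  continuous (fun wt : hofib * I01 R => (val wt.1).2 wt.2).
Proof.
have c : continuous ((fun w : hofib => (val w).2) : hofib -> {compact-open, I01 R -> B}).
  exact: continuous_compose (@continuous_snd _ _) (@continuous_val _ _).
have H := @continuous_uncurry_regular hofib (I01 R) B (fun w => (val w).2).
suff <- : uncurry (fun w : hofib => (val w).2 : I01 R -> B) =
          (fun wt : hofib * I01 R => (val wt.1).2 wt.2).
  apply: H => //; [exact: I01_locally_compact|exact: I01_regular|].
  by move=> w; have [] := homotopy_fiberP w.
by apply/funext => -[].
Qed.

Lemma homotopy_fiber_continuous (W : topologicalType) (f : W -> hofib) :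
  continuous (fun w => (val (f w)).1) ->
  continuous (fun ws : W * I01 R => (val (f ws.1)).2 ws.2) ->
  continuous f.
Proof.
move=> c1 c2; apply: continuous_set_type.
have -> : (fun w => val (f w)) = (fun w => ((val (f w)).1, (val (f w)).2)).
  by apply/funext => w; rewrite -surjective_pairing.
apply: continuous_pair => //.
exact: (continuous_curry_fun c2).
Qed.

Lemma homotopy_fiber_eq (w w' : hofib) :
  (val w).1 = (val w').1 -> (forall s, (val w).2 s = (val w').2 s) -> w = w'.
Proof.
move=> h1 h2; apply: val_inj.
by rewrite [LHS]surjective_pairing [RHS]surjective_pairing h1; congr pair; apply/funext.
Qed.

End HomotopyFiber.

(** * The fibration *)

Section PolyhedralFibration.
Variables (R : realType) (n : nat) (K : {set {set 'I_n}}).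
Variables (G : topologicalGroupType) (E : topologicalType) (act : G -> E -> E).
Hypothesis actP : continuous_action act.
Hypothesis freeP : free_action act.
Hypothesis contrE : contractible R E.
Hypothesis trivE : exists v t, @countable_trivialization R G E act v t.
Variables (A : set E).
Hypothesis A_act : forall g x, A x -> A (act g x).

Local Notation q := (orbit_proj act).
Local Notation Z := (set_type (polyhedral_product K A)).
Local Notation ZB := (set_type (polyhedral_product K (q @` A))).
Local Notation j := (polyhedral_map K A q).
Local Notation p := (polyhedral_incl K (q @` A)).

Lemma polyhedral_map_continuous : continuous (j : Z -> ZB).
Proof.
apply: continuous_set_type; apply: continuous_prod_topology => i.
apply: continuous_compose (@orbit_proj_continuous _ _ act) _.
exact: continuous_compose (@continuous_eval_at _ (fun=> E) i) (@continuous_val _ _).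
Qed.

Lemma polyhedral_productP (x : power n E) :
  polyhedral_product K (q @` A) (fun i => q (x i)) -> polyhedral_product K A x.
Proof.
move=> [s Ks sx]; exists s => // i; have := sx i; case: ifP => // _.
by move=> [y Ay /(orbit_projP actP) [g ->]]; exact: A_act.
Qed.

Lemma polyhedral_product_act (x : power n E) (g : 'I_n -> G) :
  polyhedral_product K A x -> polyhedral_product K A (fun i => act (g i) (x i)).
Proof.
move=> [s Ks sx]; exists s => // i; have := sx i; case: ifP => // _.
exact: A_act.
Qed.

Let rev (t : I01 R) : I01 R := clamp (1 - val t).

Let val_rev t : val (rev t) = 1 - val t.
Proof. by have /andP[t0 t1] := I01P t; rewrite val_clamp //; lra. Qed.

Let revK t : rev (rev t) = t.
Proof. by apply: val_inj; rewrite !val_rev; lra. Qed.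

Let rev0 : rev (I01_0 R) = I01_1 R.
Proof. by apply: val_inj; rewrite val_rev subr0. Qed.

Let rev1 : rev (I01_1 R) = I01_0 R.
Proof. by rewrite -rev0 revK. Qed.

Let rev_continuous : continuous rev.
Proof.
apply: continuous_compose (@clamp_continuous R) _.
by apply: continuous_subr; [exact: continuous_const|exact: continuous_val].
Qed.

(** The pair [(EG, G/H)] enters only through an equivariant contractible total
    space [E] and an invariant subspace [A]. Lifting is done in each coordinate
    separately, so that only the bundle [E -> E / G] has to be trivialised. *)
Theorem polyhedral_homotopy_fibration : homotopy_fibration R j p.
Proof.
split; [exact: polyhedral_map_continuous|exact: continuous_val|move=> b].
have [v [tau triv]] := trivE.
have [m mP] := contractible_paths contrE.
have [tr trP] := countable_trivialization_transport actP triv.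
pose fib := set_type (@homotopy_fiber R ZB (power n (orbit_space act)) p b).
pose e i : E := quotient_repr (b i).
have qe i : q (e i) = b i by exact: quotient_reprK.
have zc i : continuous (fun z : Z => val z i).
  exact: continuous_compose (@continuous_eval_at _ (fun=> E) i) (@continuous_val _ _).
have qc : continuous q by exact: orbit_proj_continuous.
have fibev i : continuous (fun wt : fib * I01 R => (val wt.1).2 wt.2 i).
  exact: (@continuous_compose _ _ _ (fun f : power n (orbit_space act) => f i)
    (fun wt : fib * I01 R => (val wt.1).2 wt.2)
    (@continuous_eval_at _ (fun=> orbit_space act) i)
    (@homotopy_fiber_eval_continuous _ _ _ _ _)).
(* The comparison map [h]: a point of [Z] is joined to [e] within the
   contractible space above the base. *)
pose hpath (z : Z) : I01 R -> power n (orbit_space act) :=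
  fun s i => q (m (e i) (val z i, s)).
have hpathc : continuous (fun zs : Z * I01 R => hpath zs.1 zs.2).
  apply: continuous_prod_topology => i.
  have [mc _ _ _] := mP (e i).
  apply: continuous_compose qc _; apply: continuous_compose mc _.
  apply: continuous_pair; last exact: continuous_snd.
  exact: continuous_compose (zc i) (@continuous_fst _ _).
have hP z : ((j z, hpath z) : ZB * {compact-open, I01 R -> power n (orbit_space act)})
    \in homotopy_fiber (p : ZB -> power n (orbit_space act)) b.
  apply/mem_set; split=> /=.
  - have := (continuous_curry hpathc).2 z; exact.
  - by apply/funext => i; rewrite /hpath; have [_ -> _ _] := mP (e i).
  - by apply/funext => i; rewrite /hpath; have [_ _ -> _] := mP (e i).
pose h (z : Z) : fib := SigSub (hP z).
have hc : continuous h.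
  by apply: homotopy_fiber_continuous; [exact: polyhedral_map_continuous|exact: hpathc].
exists h; split; last by [].
split=> //.
(* Lifting the reversed paths from [e] gives the inverse. *)
have lift i : exists Gamma : fib * I01 R -> E,
    [/\ continuous Gamma, forall w, Gamma (w, I01_0 R) = e i
      & forall wt, q (Gamma wt) = (val wt.1).2 (rev wt.2) i].
  apply: (covering_homotopy trP) => //.
  - apply: (@continuous_compose _ _ _ (fun wt : fib * I01 R => (val wt.1).2 wt.2 i)
      (fun wt : fib * I01 R => (wt.1, rev wt.2))) => //.
    apply: continuous_pair; first exact: continuous_fst.
    exact: continuous_compose rev_continuous (@continuous_snd _ _).
  - exact: continuous_const.
  - move=> w; rewrite /= rev0 qe.
    by have [_ _ ->] := homotopy_fiberP w.
have [Gamma GammaP] := choice lift.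
have Gc i : continuous (Gamma i) by have [] := GammaP i.
have G0 i w : Gamma i (w, I01_0 R) = e i by have [_ -> _] := GammaP i.
have qG i w t : q (Gamma i (w, t)) = (val w).2 (rev t) i by have [_ _ ->] := GammaP i.
have qG1 i w : q (Gamma i (w, I01_1 R)) = val (val w).1 i.
  by rewrite qG rev1; have [_ -> _] := homotopy_fiberP w.
have kP (w : fib) : ((fun i => Gamma i (w, I01_1 R)) : power n E) \in polyhedral_product K A.
  apply/mem_set/polyhedral_productP.
  have -> : (fun i => q (Gamma i (w, I01_1 R))) = val (val w).1.
    by apply/funext => i; exact: qG1.
  exact: set_valP.
pose k (w : fib) : Z := SigSub (kP w).
have end_c (X : topologicalType) t : continuous (fun w : X => (w, t) : X * I01 R).
  by apply: continuous_pair; [exact: continuous_id|exact: continuous_const].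
exists k; split.
- apply: continuous_set_type; apply: continuous_prod_topology => i.
  exact: continuous_compose (Gc i) (end_c fib (I01_1 R)).
- (* The path from [z] to [e] and the lift of its image differ by a path in
     [G] that ends at [1]. *)
  have theta i : exists t : Z * I01 R -> G, continuous t /\ forall zs,
      act (t zs) (m (e i) (val zs.1 i, zs.2)) = Gamma i (h zs.1, rev zs.2).
    have [mc _ _ _] := mP (e i).
    apply: (translation_continuous actP triv).
    + apply: continuous_compose mc _; apply: continuous_pair; last exact: continuous_snd.
      exact: continuous_compose (zc i) (@continuous_fst _ _).
    + apply: continuous_compose (Gc i) _; apply: continuous_pair.
        exact: continuous_compose hc (@continuous_fst _ _).
      exact: continuous_compose rev_continuous (@continuous_snd _ _).
    + by move=> [z s]; rewrite qG revK.
  have [th thP] := choice theta.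
  have HP (zs : Z * I01 R) : ((fun i => act (th i zs) (val zs.1 i)) : power n E)
      \in polyhedral_product K A.
    by apply/mem_set/polyhedral_product_act; exact: set_valP.
  exists (fun zs => SigSub (HP zs)); split.
  + apply: continuous_set_type; apply: continuous_prod_topology => i.
    apply: (continuous_act actP); first by have [] := thP i.
    exact: continuous_compose (zc i) (@continuous_fst _ _).
  + move=> z; apply: val_inj; apply/funext => i /=.
    have [_ /(_ (z, I01_0 R))] := thP i; rewrite /= rev0 => <-.
    by have [_ -> _ _] := mP (e i).
  + move=> z; apply: val_inj; apply/funext => i /=.
    have [_ /(_ (z, I01_1 R))] := thP i; rewrite /= rev1 G0.
    have [_ _ -> _] := mP (e i); move=> /freeP ->.
    by have [act1 _ _] := actP; rewrite act1.
- have Hex i : exists H : (fib * I01 R) * I01 R -> E,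
      [/\ continuous H,
          forall w s, H (w, I01_0 R, s) = m (e i) (Gamma i (w, I01_1 R), s),
          forall w s, H (w, I01_1 R, s) = Gamma i (w, rev s),
          forall w u, H (w, u, I01_0 R) = Gamma i (w, I01_1 R)
        & forall w u, H (w, u, I01_1 R) = e i].
    have [_ _ _ mH] := mP (e i).
    have [||H [Hc H1 H2 H3 H4]] := mH fib (fun ws => Gamma i (ws.1, rev ws.2)).
    + apply: continuous_compose (Gc i) _; apply: continuous_pair; first exact: continuous_fst.
      exact: continuous_compose rev_continuous (@continuous_snd _ _).
    + by move=> w; rewrite /= rev1 G0.
    by exists H; split=> // w s; rewrite ?H1 ?H3 /= rev0.
  have [H HH] := choice Hex.
  pose path (wu : fib * I01 R) : I01 R -> power n (orbit_space act) :=
    fun s i => q (H i (wu, s)).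
  have pathc : continuous (fun ws : (fib * I01 R) * I01 R => path ws.1 ws.2).
    apply: continuous_prod_topology => i; have [Hc _ _ _ _] := HH i.
    apply: continuous_compose qc _.
    have -> : (fun x : (fib * I01 R) * I01 R => H i (x.1, x.2)) = H i.
      by apply/funext => -[].
    exact: Hc.
  have FP (wu : fib * I01 R) : (((val wu.1).1, path wu) :
      ZB * {compact-open, I01 R -> power n (orbit_space act)})
      \in homotopy_fiber (p : ZB -> power n (orbit_space act)) b.
    case: wu => w u; apply/mem_set; split=> /=.
    + have := (continuous_curry pathc).2 (w, u); exact.
    + by apply/funext => i; rewrite /path; have [_ _ _ -> _] := HH i; rewrite qG1.
    + by apply/funext => i; rewrite /path; have [_ _ _ _ ->] := HH i; rewrite qe.
  exists (fun wu => SigSub (FP wu)); split.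
  + apply: homotopy_fiber_continuous; last exact: pathc.
    have c : continuous (fun w : fib => (val w).1).
      exact: continuous_compose (@continuous_fst _ _) (@continuous_val _ _).
    exact: continuous_compose c (@continuous_fst _ _).
  + move=> w; apply: homotopy_fiber_eq => /=.
      by apply: val_inj; apply/funext => i /=; rewrite qG1.
    by move=> s; apply/funext => i; rewrite /path /hpath; have [_ -> _ _ _] := HH i.
  + move=> w; apply: homotopy_fiber_eq => //= s.
    by apply/funext => i; rewrite /path; have [_ _ -> _ _] := HH i; rewrite qG revK.
Qed.

End PolyhedralFibration.

Theorem proposition1p6 (R : realType)
    (n : nat) (K : {set {set 'I_n}}) (hK : simplicial_complex K)
    (G : topologicalGroupType) (hG : lie_group R G)
    (H : set G) (hH : closed_subgroup H)
    (EG : topologicalType) (act : G -> EG -> EG)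
    (hEG : universal_space R act) :
  homotopy_fibration R
    (polyhedral_map K (EG_cosets R H EG) (EG_to_BG R H act))
    (polyhedral_incl K (BH_sub R H act)).
Proof.
have lG := lie_group_locally_compact hG.
have [hausG _ _] := hG.
have rG := hausdorff_locally_compact_regular hausG lG.
have [actP free contr num] := hEG.
have [x0 _] := contr.
have cosP := continuous_action_cosets lG rG H.
have coneP := continuous_action_cone lG rG R cosP.
apply: polyhedral_homotopy_fibration.
- exact: continuous_action_diag.
- by move=> g [x c] /(congr1 fst) /= /free.
- apply: contractible_prod => //; apply: contractible_cone.
  exact: (quotient_proj (coset_rel H) 1%g).
- apply: (countable_trivialization_pullback (act := act) (f := fst)) => //.
    exact: continuous_fst.
  exact: (numerable_countable_trivialization actP x0).
- move=> g [x c] /= [y /= ->]; exists (coset_action g y).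
  by rewrite /diag_action /= cone_actionE.
Qed.
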